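(* Let $K$ be any field, $R$ a $K$-algebra, and $J$ an ideal of $R$. If $J$ and $R/J$ are both locally f.d.ss with bounded index of nilpotence, then $R$ is locally f.d.ss with bounded index of nilpotence.
   Context: All algebras are associative but not necessarily unital $K$-algebras; ideals are two-sided ring ideals that are also $K$-subspaces. A $K$-algebra $R$ is locally f.d.ss if every finite subset of $R$ is contained in a subalgebra of $R$ that is a finite dimensional semisimple $K$-algebra. A ring $R$ has bounded index of nilpotence if there is a positive integer $n$ such that $x^n = 0$ for every nilpotent $x \in R$. *)

(* Defs.v *)
From HB Require Import structures.
From mathcomp Require Import all_boot all_order all_algebra.
Set Implicit Arguments. Unset Strict Implicit. Unset Printing Implicit Defensive.
Import GRing.Theory.
Local Open Scope ring_scope.

Record nualg (K : fieldType) := NUAlg {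
  nua_car :> lmodType K;
  nua_mul : nua_car -> nua_car -> nua_car;
  nua_mulA : forall x y z, nua_mul x (nua_mul y z) = nua_mul (nua_mul x y) z;
  nua_mulDl : forall x y z, nua_mul (x + y) z = nua_mul x z + nua_mul y z;
  nua_mulDr : forall x y z, nua_mul x (y + z) = nua_mul x y + nua_mul x z;
  nua_mulZl : forall (a : K) x y, nua_mul (a *: x) y = a *: nua_mul x y;
  nua_mulZr : forall (a : K) x y, nua_mul x (a *: y) = a *: nua_mul x y
}.

Section Defs.
Variables (K : fieldType) (A : nualg K).

Local Notation mul := (@nua_mul K A).

Definition is_subspace (S : A -> Prop) : Prop :=
  S 0 /\ (forall x y, S x -> S y -> S (x + y)) /\
  (forall (a : K) x, S x -> S (a *: x)).

Definition is_subalgebra (S : A -> Prop) : Prop :=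
  is_subspace S /\ (forall x y, S x -> S y -> S (mul x y)).

Definition is_ideal (J : A -> Prop) : Prop :=
  is_subspace J /\ (forall r x, J x -> J (mul r x)) /\
  (forall r x, J x -> J (mul x r)).

Definition is_ideal_in (S I : A -> Prop) : Prop :=
  (forall x, I x -> S x) /\ is_subspace I /\
  (forall r x, S r -> I x -> I (mul r x)) /\
  (forall r x, S r -> I x -> I (mul x r)).

Definition nilpotent_set (I : A -> Prop) : Prop :=
  exists n : nat, forall (x : A) (s : seq A),
    I x -> (forall y, y \in s -> I y) -> (n <= size s)%N -> foldl mul x s = 0.

Definition fin_dim (S : A -> Prop) : Prop :=
  exists s : seq A, forall x,
    S x <-> exists c : 'I_(size s) -> K, x = \sum_(i < size s) c i *: s`_i.

(* A finite dimensional algebra S is semisimple iff its radical (the largest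
   nilpotent ideal) is zero, i.e. S has no nonzero nilpotent ideal. *)
Definition semisimple_in (S : A -> Prop) : Prop :=
  forall I, is_ideal_in S I -> nilpotent_set I -> forall x, I x -> x = 0.

Definition fdss_subalgebra (S : A -> Prop) : Prop :=
  is_subalgebra S /\ fin_dim S /\ semisimple_in S.

(* The (non-unital) algebra P (a subalgebra of A, e.g. A itself or an ideal)
   is locally f.d.ss. *)
Definition locally_fdss_on (P : A -> Prop) : Prop :=
  forall s : seq A, (forall x, x \in s -> P x) ->
    exists S : A -> Prop, fdss_subalgebra S /\ (forall x, S x -> P x) /\
                          (forall x, x \in s -> S x).

Definition locally_fdss : Prop := locally_fdss_on (fun _ => True).

(* npow x n = x^(n+1) *)
Fixpoint npow (x : A) (n : nat) : A :=
  if n is n'.+1 then mul x (npow x n') else x.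

Definition nilpotent_elt (x : A) : Prop := exists n, npow x n = 0.

(* bounded index of nilpotence: some positive integer n = m+1 with
   x^n = 0 for every nilpotent x in P *)
Definition bounded_index_on (P : A -> Prop) : Prop :=
  exists m : nat, forall x, P x -> nilpotent_elt x -> npow x m = 0.

Definition bounded_index : Prop := bounded_index_on (fun _ => True).

End Defs.

Definition is_alg_hom (K : fieldType) (A B : nualg K) (f : A -> B) : Prop :=
  (forall x y, f (x + y) = f x + f y) /\
  (forall (a : K) x, f (a *: x) = a *: f x) /\
  (forall x y, f (nua_mul x y) = nua_mul (f x) (f y)).

(* Main.v *)
(* Semisimplicity of a finite dimensional algebra S is used in the elementwise
   form: xSx = 0 implies x = 0. Lift a spanning family of a finite dimensional
   semisimple subalgebra of Q to elements r_i of R; they fail to span an algebra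
   only up to a finite set Y of errors in J. It suffices to find an idempotent
   e of J commuting with all r_i and acting as the identity on Y: the
   elements r_i - e r_i then span an isomorphic copy of the subalgebra of Q,
   orthogonal to a corner eUe of a finite dimensional semisimple U in J that
   contains Y and the e r_i.
   To find e, start with an idempotent of J acting as the identity on Y, and
   alternately enlarge it so that its range, then its kernel, becomes stable
   under the r_i. If n consecutive steps are proper, the successive
   differences are linked in J, and the sum of the links is a nilpotent
   element of J of index about n; so the chain stops by bounded index, and
   where it stops both range and kernel are stable. *)
Require Import Defs.
From mathcomp Require Import all_boot all_order all_algebra.
From mathcomp Require Import boolp zify.
Import GRing.Theory.
Local Open Scope ring_scope.
Set Implicit Arguments. Unset Strict Implicit. Unset Printing Implicit Defensive.

Local Notation "x ** y" := (nua_mul x y) (at level 40, left associativity).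

(** * Arithmetic and linear spans in a non-unital algebra *)

Section NonUnitalAlgebra.
Variables (K : fieldType) (A : nualg K).
Implicit Types (x y z a : A) (S U P I : A -> Prop).

Lemma numul0l x : 0 ** x = 0 :> A.
Proof. by rewrite -[X in X ** _](scale0r x) nua_mulZl scale0r. Qed.

Lemma numul0r x : x ** 0 = 0 :> A.
Proof. by rewrite -[X in _ ** X](scale0r x) nua_mulZr scale0r. Qed.

Lemma numulNl x y : (- x) ** y = - (x ** y).
Proof. by rewrite -scaleN1r nua_mulZl scaleN1r. Qed.

Lemma numulNr x y : x ** (- y) = - (x ** y).
Proof. by rewrite -scaleN1r nua_mulZr scaleN1r. Qed.

Lemma numulBl x y z : (x - y) ** z = x ** z - y ** z.
Proof. by rewrite nua_mulDl numulNl. Qed.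

Lemma numulBr x y z : x ** (y - z) = x ** y - x ** z.
Proof. by rewrite nua_mulDr numulNr. Qed.

Lemma numul_suml (I : finType) (F : I -> A) y :
  (\sum_i F i) ** y = \sum_i F i ** y.
Proof.
by apply: (big_morph (fun x => x ** y)) => [u v|];
  rewrite ?nua_mulDl ?numul0l.
Qed.

Lemma numul_sumr (I : finType) (F : I -> A) x :
  x ** (\sum_i F i) = \sum_i x ** F i.
Proof.
by apply: (big_morph (fun y => x ** y)) => [u v|];
  rewrite ?nua_mulDr ?numul0r.
Qed.

Lemma subspaceN P x : is_subspace P -> P x -> P (- x).
Proof. by case=> _ [_ PZ] Px; rewrite -scaleN1r; apply: PZ. Qed.

Lemma subspaceB P x y : is_subspace P -> P x -> P y -> P (x - y).
Proof. by move=> sP Px Py; apply: sP.2.1 => //; apply: subspaceN. Qed.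

Lemma subspace_lincomb P (I : finType) (c : I -> K) (v : I -> A) :
  is_subspace P -> (forall i, P (v i)) -> P (\sum_i c i *: v i).
Proof.
move=> [P0 [PD PZ]] Pv; elim/big_ind: _ => // i _; exact: PZ.
Qed.

Definition lspan (I : finType) (v : I -> A) x :=
  exists c : I -> K, x = \sum_i c i *: v i.

Lemma lspan_subspace (I : finType) (v : I -> A) : is_subspace (lspan v).
Proof.
split; first by exists (fun=> 0); rewrite big1 // => i _; rewrite scale0r.
split=> [_ _ [c ->] [d ->]|a _ [c ->]].
  by exists (fun i => c i + d i); rewrite -big_split; apply: eq_bigr => i _;
    rewrite scalerDl.
by exists (fun i => a * c i); rewrite scaler_sumr; apply: eq_bigr => i _;
  rewrite scalerA.
Qed.

Lemma lspan_gen (I : finType) (v : I -> A) i : lspan v (v i).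
Proof.
exists (fun j => (j == i)%:R); rewrite (bigD1 i) //= eqxx scale1r big1 ?addr0 //.
by move=> j /negPf ->; rewrite scale0r.
Qed.

(** Frees spanning families from lists: later ones are indexed by ordinals or by a disjoint sum of
    two ordinals. *)
Lemma fin_dim_lspan (I : finType) (v : I -> A) S :
  (forall x, S x <-> lspan v x) -> fin_dim S.
Proof.
move=> Sv; exists [seq v i | i <- enum I] => x.
have szE : size [seq v i | i <- enum I] = #|I| by rewrite size_map -cardE.
have nthE (i : 'I_#|I|) : [seq v i | i <- enum I]`_i = v (enum_val i).
  rewrite (nth_map (enum_val i)) -?cardE //.
  by congr v; rewrite [RHS](enum_val_nth (enum_val i)).
split.
  case/Sv => c ->; exists (fun i => c (enum_val (cast_ord szE i))).
  rewrite (reindex (fun i : 'I__ => enum_val (cast_ord szE i))) /=; last first.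
    exists (fun j => cast_ord (esym szE) (enum_rank j)) => j _.
      by rewrite enum_valK cast_ordK.
    by rewrite cast_ordKV enum_rankK.
  by apply: eq_bigr => i _; rewrite -nthE.
case=> c ->; apply/Sv; apply: subspace_lincomb; first exact: lspan_subspace.
move=> i; rewrite -[val i]/(val (cast_ord szE i)) nthE; exact: lspan_gen.
Qed.

End NonUnitalAlgebra.

(** A matrix with row space inside [N] is enlarged by a vector of [N] outside it as long as one
    exists; the rank is at most [n], and [k] bounds the growth left. *)
Lemma subspace_rowspace (K : fieldType) n (N : 'rV[K]_n -> Prop) :
  N 0 -> (forall u v, N u -> N v -> N (u + v)) ->
  (forall a u, N u -> N (a *: u)) ->
  exists B : 'M[K]_n, forall v, N v <-> (v <= B)%MS.
Proof.
move=> N0 ND NZ.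
suff gen k (B : 'M[K]_n) : (forall v : 'rV_n, (v <= B)%MS -> N v) ->
    (n - \rank B <= k)%N -> exists B : 'M[K]_n, forall v, N v <-> (v <= B)%MS.
  apply: (gen n 0) => [v|]; first by rewrite submx0 => /eqP ->.
  exact: leq_subr.
elim: k B => [|k IH] B BN rB.
all: have [NB|/existsNP[v /not_implyP[Nv nBv]]] :=
  pselect (forall v, N v -> (v <= B)%MS);
  first by exists B => v; split; [apply: NB|apply: BN].
all: have ltB : (\rank B < \rank (B + v)%MS)%N
  by apply: rank_ltmx; rewrite ltmxE addsmxSl addsmx_sub submx_refl;
  apply/negP.
  by have := rank_leq_row (B + v)%MS; lia.
apply: (IH (B + v)%MS); last lia.
move=> u /sub_addsmxP[[u1 u2] /= ->]; apply: ND; first exact/BN/submxMl.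
by rewrite [u2]mx11_scalar mul_scalar_mx; apply: NZ.
Qed.

(** * Finite dimensional semiprime algebras: idempotents and the unit *)

Section FiniteDimensional.
Variables (K : fieldType) (A : nualg K).
Implicit Types (x y z a e f : A) (S U P I : A -> Prop).

(** Descent on the rank of the space of coefficient vectors over a spanning list of [U]. The list
    may be linearly dependent: strict inclusion still lowers this rank. *)
Lemma fin_dim_minimal U (F : (A -> Prop) -> Prop) :
  fin_dim U -> (forall P, F P -> is_subspace P /\ forall x, P x -> U x) ->
  (exists P, F P) ->
  exists P, F P /\ forall P', F P' -> (forall x, P' x -> P x) ->
    forall x, P x -> P' x.
Proof.
move=> [s Us] FU [P0 FP0].
pose lc (c : 'rV[K]_(size s)) : A := \sum_i c 0 i *: s`_i.
have repr P : F P -> exists B : 'M[K]_(size s), forall c, P (lc c) <-> (c <= B)%MS.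
  move=> /FU[[Z [D M]] _]; apply: subspace_rowspace => [|u v Pu Pv|a u Pu].
  - by rewrite /lc big1 // => i _; rewrite mxE scale0r.
  - have -> : lc (u + v) = lc u + lc v; last exact: D.
    by rewrite /lc -big_split; apply: eq_bigr => i _; rewrite mxE scalerDl.
  - have -> : lc (a *: u) = a *: lc u; last exact: M.
    by rewrite /lc scaler_sumr; apply: eq_bigr => i _; rewrite mxE scalerA.
suff gen k P (B : 'M[K]_(size s)) : F P ->
    (forall c, P (lc c) <-> (c <= B)%MS) -> (\rank B < k)%N ->
    exists P, F P /\ forall P', F P' -> (forall x, P' x -> P x) ->
    forall x, P x -> P' x.
  by have [B PB] := repr _ FP0; apply: (gen (\rank B).+1 P0 B).
elim: k P B => // k IH P B FP PB rB.
have [minP|] := pselect (forall P', F P' -> (forall x, P' x -> P x) ->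
  forall x, P x -> P' x); first by exists P.
move=> /existsNP[P' /not_implyP[FP' /not_implyP[P'P]]].
move=> /existsNP[x /not_implyP[Px nP'x]].
have [B' P'B'] := repr _ FP'.
apply: (IH P' B') => //; rewrite ltnS in rB; apply: leq_trans rB.
have [c xE] : exists c, x = lc c.
  have /(FU _ FP).2/Us[c ->] := Px; exists (\row_i c i).
  by apply: eq_bigr => i _; rewrite mxE.
apply: rank_ltmx; rewrite ltmxE; apply/andP; split.
  by apply/rV_subP => u /P'B'/P'P/PB.
apply/negP => BB'; apply: nP'x; rewrite xE; apply/P'B'.
by apply: submx_trans BB'; apply/PB; rewrite -xE.
Qed.

Definition semiprime_on S :=
  forall x, S x -> (forall y, S y -> x ** y ** x = 0) -> x = 0.

(** Induction on the nilpotency exponent. If p is a product of elements of [I] one factor too short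
    to vanish, then p y p is long enough, since y p is again in [I]; semiprimeness gives p = 0. *)
Lemma semiprime_semisimple S :
  is_subalgebra S -> semiprime_on S -> semisimple_in S.
Proof.
move=> [sS SM] spS I [IS [sI [IMl IMr]]] [n In].
elim: n In => [|n IH] In; first by move=> x Ix; apply: (In x [::]).
apply: IH => x s Ix Is; rewrite leq_eqVlt => /orP[/eqP szs|]; last exact: In.
have Ip : I (foldl (@nua_mul K A) x s).
  elim: s x Ix Is {szs} => //= y s IH x Ix Is; apply: IH => [|z zs].
    by apply: IMl; [apply: IS|apply: Is; rewrite mem_head].
  by apply: Is; rewrite in_cons zs orbT.
apply: spS => [|y Sy]; first exact: IS.
have := In x (rcons s (y ** foldl (@nua_mul K A) x s)) Ix.
rewrite foldl_rcons nua_mulA size_rcons szs; apply=> // z.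
rewrite mem_rcons in_cons => /orP[/eqP -> |]; last exact: Is.
exact: IMl.
Qed.

Lemma square_zero_ideal S I : semisimple_in S -> is_ideal_in S I ->
  (forall x y, I x -> I y -> x ** y = 0) -> forall x, I x -> x = 0.
Proof.
move=> ssS idI I2; apply: ssS => //; exists 1%N => x [//|y s] Ix Is _ /=.
rewrite I2 //; last by apply: Is; rewrite mem_head.
by elim: s {Is} => //= z s IHs; rewrite numul0l.
Qed.

(* If xSx = 0, let B be the right annihilator of xS and C the left annihilator
   of B: then B and C are ideals, their intersection has square zero and contains xS. *)
Lemma semisimple_semiprime S :
  is_subalgebra S -> semisimple_in S -> semiprime_on S.
Proof.
move=> [sS SM] ssS x Sx xSx.
have [S0 [SD SZ]] := sS.
have xS0 u : S u -> x ** u = 0.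
  move=> Su.
  pose B y := S y /\ forall v, S v -> x ** v ** y = 0.
  pose C z := S z /\ forall y, B y -> z ** y = 0.
  apply: (@square_zero_ideal S (fun y => B y /\ C y)) => //.
  - split; first by move=> y [[]].
    split.
      split; first by do 2!split=> //; move=> v _; rewrite ?numul0r ?numul0l.
      split=> [y z|a y].
        move=> [[Sy By] [_ Cy]] [[Sz Bz] [_ Cz]]; split; split=> [|v Hv];
          try exact: SD.
          by rewrite nua_mulDr By // Bz // addr0.
        by rewrite nua_mulDl Cy // Cz // addr0.
      move=> [[Sy By] [_ Cy]]; split; split=> [|v Hv]; try exact: SZ.
        by rewrite nua_mulZr By // scaler0.
      by rewrite nua_mulZl Cy // scaler0.
    split=> r y Sr [[Sy By] [_ Cy]]; split; split=> [|v Hv]; try exact: SM.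
    + by rewrite nua_mulA -(nua_mulA x) By //; apply: SM.
    + by rewrite -nua_mulA Cy // numul0r.
    + by rewrite nua_mulA By // numul0l.
    + rewrite -nua_mulA; apply: Cy; split; first exact/SM/Hv.1.
      by move=> w Sw; rewrite nua_mulA -(nua_mulA x) Hv.2 //; apply: SM.
  - by move=> y z [_ [_ Cy]] [Bz _]; apply: Cy.
  - split; split; try exact: SM.
      by move=> v Sv; rewrite nua_mulA xSx // numul0l.
    by move=> y [_ By]; apply: By.
(* Now x S = 0, and the elements y of [S] with y S = 0 form another ideal of square zero. *)
apply: (@square_zero_ideal S (fun y => S y /\ forall u, S u -> y ** u = 0)) => //.
- split; first by move=> y [].
  split.
    split; first by split=> // u _; rewrite numul0l.
    split=> [y z [Sy y0] [Sz z0]|a y [Sy y0]].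
      by split=> [|u Su]; [exact: SD|rewrite nua_mulDl y0 // z0 // addr0].
    by split=> [|u Su]; [exact: SZ|rewrite nua_mulZl y0 // scaler0].
  split=> r y Sr [Sy y0]; split=> [|u Su]; try exact: SM.
    by rewrite -nua_mulA y0 // numul0r.
  by rewrite -nua_mulA y0 //; apply: SM.
- by move=> y z [_ y0] [Sz _]; apply: y0.
Qed.

Definition is_right_ideal_in U I :=
  [/\ forall x, I x -> U x, is_subspace I & forall x u, I x -> U u -> I (x ** u)].

Section Semiprime.
Variable U : A -> Prop.
Hypotheses (subU : is_subalgebra U) (fdU : fin_dim U) (spU : semiprime_on U).

(** Take a minimal nonzero right ideal M inside [I]. Semiprimeness gives z, w in M with z w <> 0.
    Then z M = M provides m with z m = z, and m m - m lies in the right annihilator of z in M, which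
    is zero by minimality. *)
Lemma right_ideal_nz_idempotent I x :
  is_right_ideal_in U I -> I x -> x <> 0 ->
  exists e, [/\ I e, e ** e = e & e <> 0].
Proof.
move=> idI Ix nzx.
have [M [[idM MI [w [Mw nzw]]] minM]] := @fin_dim_minimal U
  (fun M => [/\ is_right_ideal_in U M, forall x, M x -> I x
               & exists x, M x /\ x <> 0]) fdU
  (fun M '(And3 (And3 MU sM _) _ _) => conj sM MU)
  (ex_intro _ I (And3 idI (fun x => id) (ex_intro _ x (conj Ix nzx)))).
have [MU sM MMr] := idM; have [M0 [MD MZ]] := sM.
have [z [Mz nzz]] : exists z, M z /\ z ** w <> 0.
  apply: contrapT => nex; apply: nzw; apply: spU => [|y Uy]; first exact: MU.
  by apply: contrapT => nz; apply: nex; exists (w ** y); split=> //; apply: MMr.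
have [m [Mm zm]] : exists m, M m /\ z ** m = z.
  have := minM (fun t => exists m, M m /\ z ** m = t); case/(_ _ _ z Mz) => //.
  - split.
    + split=> [_ [m [Mm <-]]||_ u [m [Mm <-]] Uu].
      * by apply: subU.2; apply: MU.
      * split; first by exists 0; rewrite numul0r.
        split=> [_ _ [m [Mm <-]] [n [Mn <-]]|a _ [m [Mm <-]]].
          by exists (m + n); rewrite nua_mulDr; split=> //; apply: MD.
        by exists (a *: m); rewrite nua_mulZr; split=> //; apply: MZ.
      * by exists (m ** u); rewrite nua_mulA; split=> //; apply: MMr.
    + by move=> _ [m [Mm <-]]; apply: MI; apply: MMr => //; apply: MU.
    + by exists (z ** w); split=> //; exists w.
  - by move=> _ [m [Mm <-]]; apply: MMr => //; apply: MU.
  - by move=> m mP; exists m.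
exists m; split; first exact: MI.
  have sub0 : m ** m - m = 0; last by apply/eqP; rewrite -subr_eq0 sub0.
  apply: contrapT => nz; apply: nzz.
  suff H : M w -> M w /\ z ** w = 0 by case: (H Mw).
  apply: (minM (fun t => M t /\ z ** t = 0)) => [|t []//].
  split=> [|t []|]; last 1 first.
  - exists (m ** m - m); split=> //; split.
      by apply: subspaceB => //; apply: MMr => //; apply: MU.
    by rewrite numulBr nua_mulA !zm subrr.
  - split=> [t []||t u [Mt zt] Uu]; first by move/MU.
    + split; first by rewrite numul0r.
      split=> [s t [Ms zs] [Mt zt]|a t [Mt zt]].
        by rewrite nua_mulDr zs zt addr0; split=> //; apply: MD.
      by rewrite nua_mulZr zt scaler0; split=> //; apply: MZ.
    + by rewrite nua_mulA zt numul0l; split=> //; apply: MMr.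
  - by move/MI.
by move=> m0; apply: nzz; rewrite -zm m0 numul0r numul0l.
Qed.

(** Choose an idempotent e of [I] with minimal right annihilator in [I]. If e y <> y, this
    annihilator contains y - e y, hence a nonzero idempotent f; then e + f - f e is an idempotent of
    [I] whose annihilator is smaller, because it misses f. *)
Lemma right_ideal_idempotent I : is_right_ideal_in U I ->
  exists e, [/\ I e, e ** e = e & forall y, I y -> e ** y = y].
Proof.
move=> idI; have [IU sI IMr] := idI; have [I0 [ID IZ]] := sI.
pose ann e t := I t /\ e ** t = 0.
have idA e : is_right_ideal_in U (ann e).
  split=> [t [/IU//]||t u [It et] Uu]; last first.
    by split; [apply: IMr|rewrite nua_mulA et numul0l].
  split; first by split=> //; rewrite numul0r.
  split=> [s t [Is es] [It et]|a t [It et]].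
    by split; [apply: ID|rewrite nua_mulDr es et addr0].
  by split; [apply: IZ|rewrite nua_mulZr et scaler0].
have [P [[e [Ie ee PE]] minP]] := @fin_dim_minimal U
  (fun P => exists e, [/\ I e, e ** e = e & P = ann e]) fdU
  (fun P '(ex_intro e (And3 _ _ E)) =>
     let: And3 AU sA _ := idA e in
     eq_ind_r (fun Q => is_subspace Q /\ forall x, Q x -> U x) (conj sA AU) E)
  (ex_intro _ _ (ex_intro _ 0 (And3 I0 (numul0r _) erefl))).
exists e; split=> // y Iy.
apply: contrapT => ney.
have [f [[If ef] ff nzf]] : exists f, [/\ ann e f, f ** f = f & f <> 0].
  apply: (@right_ideal_nz_idempotent (ann e) (y - e ** y)) => //.
    split; last by rewrite numulBr nua_mulA ee subrr.
    by apply: subspaceB => //; apply: IMr => //; apply: IU.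
  by move=> /eqP; rewrite subr_eq0 eq_sym => /eqP.
pose e' := e + f - f ** e.
have e'e : e' ** e = e.
  by rewrite numulBl nua_mulDl -nua_mulA ee addrK.
have e'f : e' ** f = f.
  by rewrite numulBl nua_mulDl -nua_mulA ef ff numul0r subr0 add0r.
have Ie' : I e' by apply: subspaceB; [|apply: ID|apply: IMr => //; apply: IU].
have ee' : e ** e' = e by rewrite numulBr nua_mulDr nua_mulA ef numul0l ee subr0 addr0.
have : ann e' f.
  apply: (minP (ann e')); rewrite ?PE //.
    exists e'; split=> //; rewrite {2}/e' numulBr nua_mulDr nua_mulA.
    by rewrite e'f e'e.
  by move=> t [It e't]; split=> //; rewrite -ee' -nua_mulA e't numul0r.
by case=> _; rewrite e'f.
Qed.

(** [U], as a right ideal of itself, has a left identity e; then (y - y e) U = 0, so y = y e by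
    semiprimeness. *)
Lemma semiprime_unit : exists e, U e /\ forall y, U y -> e ** y = y /\ y ** e = y.
Proof.
have [U0 [UD UZ]] := subU.1.
have [|e [Ue ee eU]] := @right_ideal_idempotent U.
  by split=> //; exact: subU.2.
exists e; split=> // y Uy; split; first exact: eU.
apply/eqP; rewrite eq_sym -subr_eq0; apply/eqP; apply: spU => [|z Uz].
  by apply: subspaceB => //; apply: subU.2.
by rewrite numulBl -nua_mulA eU // subrr numul0l.
Qed.

End Semiprime.
End FiniteDimensional.

(** * The opposite algebra, and relations between idempotents *)

Definition nualg_op (K : fieldType) (A : nualg K) : nualg K :=
  @NUAlg K A (fun x y => y ** x)
    (fun x y z => esym (nua_mulA z y x))
    (fun x y z => nua_mulDr z x y) (fun x y z => nua_mulDl y z x)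
    (fun a x y => nua_mulZr a y x) (fun a x y => nua_mulZl a y x).

Definition locally_semiprime (K : fieldType) (A : nualg K) (J : A -> Prop) :=
  forall s : seq A, (forall x, x \in s -> J x) ->
  exists U : A -> Prop, [/\ is_subalgebra U, fin_dim U, semiprime_on U,
    forall x, U x -> J x & forall x, x \in s -> U x].

(* f acts as the identity on the errors made by the r i in being closed under
   multiplication up to linear combinations. *)
Definition closed_mod (K : fieldType) (A : nualg K) (I : finType) (r : I -> A)
    (f : A) :=
  forall i j, exists (c : I -> K) (y : A),
    [/\ r i ** r j = \sum_k c k *: r k + y, f ** y = y & y ** f = y].

(** Left multiplication by each [r i] preserves the range of left multiplication by [f]. Read in the
    opposite algebra, the condition is f r = f r f, which says that the kernel is preserved. *)
Definition right_invariant (K : fieldType) (A : nualg K) (I : finType)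
  (r : I -> A) (f : A) := forall i, r i ** f = f ** (r i ** f).

(* For idempotents g and g': the left ideal annihilating g' J g is no larger than
   the one annihilating g'. *)
Definition linked (K : fieldType) (A : nualg K) (J : A -> Prop) (g g' : A) :=
  forall a, (forall u, J u -> a ** g' ** u ** g = 0) -> a ** g' = 0.

Definition idempotent_le (K : fieldType) (A : nualg K) (f f' : A) :=
  [/\ f ** f = f, f' ** f' = f', f ** f' = f & f' ** f = f].

Section Opposite.
Variables (K : fieldType) (A : nualg K) (J : A -> Prop).

Lemma is_ideal_op : is_ideal J -> @is_ideal K (nualg_op A) J.
Proof. by move=> [sJ [Jl Jr]]; split=> //; split. Qed.

Lemma locally_semiprime_op :
  locally_semiprime J -> @locally_semiprime K (nualg_op A) J.
Proof.
move=> lsJ s /lsJ[U [[sU UM] fdU spU UJ sUs]]; exists U; split=> //.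
  by split=> // x y Ux Uy; apply: UM.
move=> x Ux xUx; apply: spU => // y Uy.
by rewrite -nua_mulA; apply: xUx.
Qed.

Lemma closed_mod_op (I : finType) (r : I -> A) f :
  closed_mod r f -> @closed_mod K (nualg_op A) I r f.
Proof. by move=> cl i j; have [c [y []]] := cl j i; exists c, y. Qed.

Lemma idempotent_le_op (f f' : A) :
  idempotent_le f f' -> @idempotent_le K (nualg_op A) f f'.
Proof. by case. Qed.

Lemma locally_semiprime_semiprime : locally_semiprime J -> semiprime_on J.
Proof.
move=> lsJ x Jx xJx; have [|U [_ _ spU UJ xU]] := lsJ [:: x].
  by move=> y; rewrite inE => /eqP ->.
by apply: spU => [|y /UJ]; [apply: xU; rewrite inE|apply: xJx].
Qed.

(** Suppose a g' J g = 0. For u, v in [J] the element t = g u g' v a g' satisfies t J t = 0, because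
    a g' w g occurs in t w t; so t = 0. The opposite link then gives g' v a g' = 0, and
    semiprimeness applied to a g' concludes. *)
Lemma linked_op (g g' : A) : is_ideal J -> semiprime_on J -> J g' ->
  @linked K (nualg_op A) J g g' -> linked J g g'.
Proof.
move=> [sJ [Jl Jr]] spJ Jg' lk a ag.
have g'Jag' v : J v -> g' ** (v ** a ** g') = 0.
  move=> Jv; apply: (lk (v ** a ** g')) => u Ju.
  suff gu0 (t : A) : J t -> g ** (t ** (g' ** (v ** a ** g'))) = 0 by apply: gu0.
  move=> {u Ju} Ju; move: t Ju => u Ju.
  apply: spJ => [|w Jw]; first exact/Jl/Jr.
  rewrite !nua_mulA; have := ag w Jw.
  set t := g ** u ** g' ** v => tE.
  have -> : t ** a ** g' ** w ** g = t ** (a ** g' ** w ** g).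
    by rewrite !nua_mulA.
  by rewrite tE numul0r !numul0l.
apply: spJ => [|v Jv]; first exact: Jl.
by rewrite -[RHS](numul0r a) -(g'Jag' v Jv) !nua_mulA.
Qed.

End Opposite.

(** * Enlarging an idempotent to a right-invariant one *)

Section Chain.
Variables (K : fieldType) (A : nualg K) (J : A -> Prop).
Variables (I : finType) (r : I -> A).
Hypotheses (idJ : is_ideal J) (lsJ : locally_semiprime J).
Implicit Types (a b f g x y z : A).

(* The right ideal generated by f and the r i ** f is replaced by the double
   annihilator, which is a right ideal described without sums. *)
Lemma right_step f : J f -> f ** f = f -> closed_mod r f ->
  exists f', [/\ J f', idempotent_le f f', right_invariant r f'
    & forall a, a ** f = 0 -> (forall i, a ** (r i ** f) = 0) -> a ** f' = 0].
Proof.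
move=> Jf ff cl; have [sJ [Jl Jr]] := idJ.
have [|U [sU fdU spU UJ inU]] := lsJ (s := f :: [seq r i ** f | i <- enum I]).
  by move=> x; rewrite in_cons => /orP[/eqP ->//|/mapP[i _ ->]]; apply: Jl.
have Uf : U f by apply: inU; rewrite mem_head.
have Ur i : U (r i ** f).
  by apply: inU; rewrite in_cons (map_f (fun i => r i ** f)) ?orbT ?mem_enum.
have [sU' UM] := sU; have [U0 [UD UZ]] := sU'.
pose D y := U y /\
  forall a, a ** f = 0 -> (forall i, a ** (r i ** f) = 0) -> a ** y = 0.
have sD : is_subspace D.
  split; first by split=> // a _ _; rewrite numul0r.
  split=> [x y [Ux Dx] [Uy Dy]|k x [Ux Dx]].
    split; first exact: UD.
    by move=> a af ar; rewrite nua_mulDr Dx // Dy // addr0.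
  split; first exact: UZ.
  by move=> a af ar; rewrite nua_mulZr Dx // scaler0.
have idD : is_right_ideal_in U D.
  split=> // [x []//|x u [Ux Dx] Uu].
  split; first exact: UM.
  by move=> a af ar; rewrite nua_mulA Dx // numul0l.
have Df : D f by [].
have Dr i : D (r i ** f) by [].
have [e [De ee eD]] := right_ideal_idempotent sU fdU spU idD.
(* Like e, this is a left identity on [D]; the correction f - f e is there to make f f' = f as
   well. *)
pose f' := e + f - f ** e.
have f'D y : D y -> f' ** y = y.
  by move=> Dy; rewrite numulBl nua_mulDl -nua_mulA eD // addrK.
have Df' : D f'.
  apply: subspaceB => //; first exact: sD.2.1.
  by case: idD => _ _; apply=> //; case: De.
have ff' : f ** f' = f by rewrite numulBr nua_mulDr nua_mulA ff addrC addKr.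
clearbody f'; exists f'; split.
- by apply: UJ; case: Df'.
- by split=> //; apply: f'D.
- move=> i; apply/eqP; rewrite nua_mulA -subr_eq0 -numulBl; apply/eqP.
  (* The annihilators in [D] range over the whole algebra, so r i - f' r i is allowed even though it
     need not lie in [U]. It kills r j f because [cl] writes r i r j f as a combination of elements
     of [D], plus an error fixed by f. *)
  have [_] := Df'; apply=> [|j].
    by rewrite numulBl -nua_mulA f'D // subrr.
  have [c [y [rr fy yf]]] := cl i j.
  rewrite numulBl -[X in _ - X]nua_mulA; apply/eqP.
  rewrite subr_eq0 eq_sym; apply/eqP.
  rewrite (nua_mulA (r i)) rr nua_mulDl numul_suml nua_mulDr yf; congr (_ + _).
    apply: f'D; have -> : \sum_k c k *: r k ** f = \sum_k c k *: (r k ** f).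
      by apply: eq_bigr => k _; rewrite nua_mulZl.
    exact: subspace_lincomb.
  by rewrite -fy nua_mulA f'D.
- by case: Df'.
Qed.

(** For the link, put g = f' - f and g'' = f'' - f', and assume a g'' J g = 0. Invariance of f gives
    r i f' = f r i f + r i g g. Here g'' kills the first term and a g'' the second; a g'' also kills
    f', hence f'', so a g'' = a g'' f'' = 0. *)
Lemma right_next f f' : J f -> J f' -> idempotent_le f f' ->
  right_invariant r f -> closed_mod r f' ->
  exists f'', [/\ J f'', idempotent_le f' f'', right_invariant r f''
    & linked J (f' - f) (f'' - f')].
Proof.
move=> Jf Jf' [ff f'f' ff' f'f] rf cl; have [sJ [Jl Jr]] := idJ.
have [f'' [Jf'' le_f'' rf'' gen]] := right_step Jf' f'f' cl.
exists f''; split=> // a ag; have [_ f''f'' f'f'' f''f'] := le_f''.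
have g''f' : (f'' - f') ** f' = 0 by rewrite numulBl f''f' f'f' subrr.
have g''f : (f'' - f') ** f = 0 by rewrite -f'f nua_mulA g''f' numul0l.
have g''f'' : (f'' - f') ** f'' = f'' - f' by rewrite numulBl f''f'' f'f''.
have g'g' : (f' - f) ** (f' - f) = f' - f.
  by rewrite numulBl !numulBr f'f' f'f ff' ff subrr subr0.
rewrite -g''f'' nua_mulA; apply: gen => [|i].
  by rewrite -nua_mulA g''f' numul0r.
have -> : r i ** f' = f ** (r i ** f) + r i ** (f' - f) ** (f' - f).
  by rewrite -nua_mulA g'g' numulBr -rf addrC subrK.
rewrite nua_mulDr !nua_mulA -(nua_mulA a _ f) g''f numul0r !numul0l add0r.
by rewrite -(nua_mulA _ (r i)) ag //; apply: Jl; apply: subspaceB.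
Qed.

End Chain.

(** * An idempotent commuting with the family [r] *)

Section CentralIdempotent.
Variables (K : fieldType) (A : nualg K) (J : A -> Prop).
Variables (I : finType) (r : I -> A).
Hypotheses (idJ : is_ideal J) (lsJ : locally_semiprime J).
Implicit Types (a b f g x y z : A).

Definition left_invariant f := @right_invariant K (nualg_op A) I r f.

Lemma left_next f f' : J f -> J f' -> idempotent_le f f' ->
  left_invariant f -> closed_mod r f' ->
  exists f'', [/\ J f'', idempotent_le f' f'', left_invariant f''
    & linked J (f' - f) (f'' - f')].
Proof.
move=> Jf Jf' le_ff' lf cl.
have [f'' [Jf'' /idempotent_le_op le_f'' lf'' lk]] :=
  right_next (is_ideal_op idJ) (locally_semiprime_op lsJ) Jf Jf'
    (idempotent_le_op le_ff') lf (closed_mod_op cl).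
exists f''; split=> //; apply: linked_op => //.
  exact: locally_semiprime_semiprime.
by apply: subspaceB => //; case: idJ.
Qed.

Lemma iter_mulr k x z : iter k.+1 (fun t => t ** x) z = z ** npow x k.
Proof. by elim: k z => // k IH z; rewrite iterSr IH nua_mulA. Qed.

Lemma iter_mulr_add k x b z : z ** b = 0 -> x ** b = 0 ->
  iter k (fun t => t ** (b + x)) z = iter k (fun t => t ** x) z.
Proof.
move=> zb xb; elim: k => //= k ->; rewrite nua_mulDr.
by case: k => [|k] /=; rewrite ?zb ?add0r // -nua_mulA xb numul0r add0r.
Qed.

(* A strictly increasing chain of k+1 linked idempotents yields a nilpotent x,
   the sum of the links, with x^k <> 0. *)
Definition has_nilpotents k f f' :=
  forall a, a ** (f' - f) <> 0 -> exists x,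
    [/\ J x, x ** f = x, f' ** x = x,
        forall z, iter k.+1 (fun t => t ** x) z = 0
      & iter k (fun t => t ** x) (a ** (f' - f)) <> 0].

(** Linkedness supplies b in g'' J g' with a b <> 0, and the new nilpotent is b + x. Since b b = x b
    = 0, b can only be the first factor of a nonzero product, so vanishing and nonvanishing both
    move up by one exponent. *)
Lemma has_nilpotents_step k f f' f'' :
  idempotent_le f f' -> idempotent_le f' f'' -> J f' -> J f ->
  linked J (f' - f) (f'' - f') ->
  has_nilpotents k f f' -> has_nilpotents k.+1 f' f''.
Proof.
move=> [ff f'f' ff' f'f] [_ f''f'' f'f'' f''f'] Jf' Jf lk nil a nza.
have [sJ [Jl Jr]] := idJ.
set g' := f' - f in lk *; set g'' := f'' - f' in lk nza *.
have g'g' : g' ** g' = g' by rewrite numulBl !numulBr f'f' f'f ff' ff subrr subr0.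
have g'f' : g' ** f' = g' by rewrite numulBl f'f' ff'.
have f''g'' : f'' ** g'' = g'' by rewrite numulBr f''f'' f''f'.
have g''g'' : g'' ** g'' = g''.
  by rewrite {1}/g'' numulBl f''g'' numulBr f'f'' f'f' subrr subr0.
have g''f' : g'' ** f' = 0 by rewrite numulBl f''f' f'f' subrr.
have f'g'' : f' ** g'' = 0 by rewrite numulBr f'f'' f'f' subrr.
have fg'' : f ** g'' = 0 by rewrite -ff' -nua_mulA f'g'' numul0r.
have g'g'' : g' ** g'' = 0 by rewrite numulBl f'g'' fg'' subrr.
have [u [Ju nzu]] : exists u, J u /\ a ** g'' ** u ** g' <> 0.
  apply: contrapT => nex; apply: nza; apply: lk => u Ju.
  by apply: contrapT => nz; apply: nex; exists u.
clearbody g''.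
pose b := g'' ** u ** g'.
have bg' : b ** g' = b by rewrite -nua_mulA g'g'.
have g''b : g'' ** b = b by rewrite !nua_mulA g''g''.
have Jb : J b by apply/Jr/Jl.
have ab : a ** b = a ** g'' ** u ** g' by rewrite !nua_mulA.
clearbody b.
have [|x [Jx xf f'x xnil xnz]] := nil (a ** b).
  by rewrite -/g' -nua_mulA bg' ab.
rewrite -/g' -nua_mulA bg' in xnz.
have xb : x ** b = 0.
  by rewrite -g''b nua_mulA -xf -[X in X ** b]nua_mulA fg'' numul0r numul0l.
have bb : b ** b = 0.
  by rewrite -{1}bg' -{2}g''b -nua_mulA (nua_mulA g') g'g'' numul0l numul0r.
exists (b + x); split.
- exact: sJ.2.1.
- rewrite nua_mulDl -{1}bg' -nua_mulA g'f' bg'.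
  by rewrite -{1}xf -nua_mulA ff' xf.
- rewrite nua_mulDr -{1}g''b nua_mulA f''g'' g''b.
  by rewrite -{1}f'x nua_mulA f''f' f'x.
- move=> z; rewrite iterSr iter_mulr_add //.
  by rewrite -nua_mulA nua_mulDl bb xb addr0 numul0r.
- rewrite iterSr.
  have -> : a ** g'' ** (b + x) = a ** b.
    have g''x : g'' ** x = 0 by rewrite -f'x nua_mulA g''f' numul0l.
    by rewrite -nua_mulA nua_mulDr g''b g''x addr0.
  by rewrite iter_mulr_add // -nua_mulA bb numul0r.
Qed.

Lemma closed_mod_le f f' : idempotent_le f f' -> closed_mod r f -> closed_mod r f'.
Proof.
move=> [_ _ ff' f'f] cl i j; have [c [y [rr fy yf]]] := cl i j.
exists c, y; split=> //; first by rewrite -fy nua_mulA f'f.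
by rewrite -yf -nua_mulA ff'.
Qed.

Lemma idempotent_le_trans f f' f'' :
  idempotent_le f f' -> idempotent_le f' f'' -> idempotent_le f f''.
Proof.
move=> [ff _ ff' f'f] [_ f''f'' f'f'' f''f']; split=> //.
  by rewrite -ff' -nua_mulA f'f''.
by rewrite -f'f nua_mulA f''f'.
Qed.

Lemma central_idempotent f0 : bounded_index_on J ->
  J f0 -> f0 ** f0 = f0 -> closed_mod r f0 ->
  exists e, [/\ J e, idempotent_le f0 e & forall i, r i ** e = e ** r i].
Proof.
move=> [m bdJ] Jf0 f0f0 cl0.
(* The chain may become constant: [has_nilpotents] holds vacuously once f' = f. *)
have chain k : exists f f',
    [/\ [/\ J f, J f', idempotent_le f0 f & idempotent_le f f'],
        has_nilpotents k f f'
      & right_invariant r f /\ left_invariant f' \/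
        left_invariant f /\ right_invariant r f'].
  elim: k => [|k [f [f' [[Jf Jf' le_f le_f'] nil inv]]]].
    have [f1 [Jf1 le_f1 rf1 _]] := right_step idJ lsJ Jf0 f0f0 cl0.
    have [f2 [Jf2 /idempotent_le_op le_f2 lf2 _]] :=
      right_step (is_ideal_op idJ) (locally_semiprime_op lsJ) Jf1
        (let: And4 _ h _ _ := le_f1 in h) (closed_mod_op (closed_mod_le le_f1 cl0)).
    exists f1, f2; split=> //; last by left.
    move=> a nza; exists 0; split=> //=; rewrite ?numul0l ?numul0r //.
      by case: idJ => [[]].
    by move=> z; rewrite numul0r.
  have cl' := closed_mod_le (idempotent_le_trans le_f le_f') cl0.
  have [f'' [Jf'' le_f'' inv'' lk]] : exists f'', [/\ J f'', idempotent_le f' f'',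
      right_invariant r f' /\ left_invariant f'' \/
      left_invariant f' /\ right_invariant r f'' & linked J (f' - f) (f'' - f')].
    case: inv => [[rf lf']|[lf rf']].
      have [f'' [? ? ? ?]] := right_next idJ lsJ Jf Jf' le_f' rf cl'.
      by exists f''; split=> //; right.
    have [f'' [? ? ? ?]] := left_next Jf Jf' le_f' lf cl'.
    by exists f''; split=> //; left.
  exists f', f''; split=> //; first by split=> //; exact: idempotent_le_trans le_f le_f'.
  exact: has_nilpotents_step le_f' le_f'' Jf' Jf lk nil.
(* [npow x m] is the power m+1, which vanishes on nilpotents of [J]; at k = m+1 a nonzero last
   difference would contradict this. So f' = f, and this idempotent is invariant on both sides. *)
have [f [f' [[Jf Jf' le_f [ff f'f' ff' f'f]] nil inv]]] := chain m.+1.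
have eq_f : f' = f.
  apply/eqP; rewrite -subr_eq0; apply/eqP; apply: contrapT => nz.
  have [|x [Jx _ _ xnil]] := nil (f' - f).
    by rewrite numulBl !numulBr f'f' f'f ff' ff subrr subr0.
  rewrite iter_mulr bdJ ?numul0r //; exists m.+2.
  by have := xnil x; rewrite iter_mulr.
rewrite {}eq_f in inv; exists f; split=> // i.
have {inv}[rf lf] : right_invariant r f /\ left_invariant f.
  by case: inv => [][].
rewrite rf; apply: esym; rewrite nua_mulA; exact: lf.
Qed.

End CentralIdempotent.

(** * Corners, orthogonal sums and powers *)

Section Assembly.
Variables (K : fieldType) (A : nualg K).
Implicit Types (a b e x y : A) (C U V S : A -> Prop).

Lemma locally_fdss_semiprime S : locally_fdss_on S -> locally_semiprime S.
Proof.
move=> lS s /lS[U [[sU [fdU ssU]] [US sUs]]].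
by exists U; split=> //; apply: semisimple_semiprime.
Qed.

Definition corner U e x := [/\ U x, e ** x = x & x ** e = x].

(** For x in the corner, x u x = x (e u e) x, so testing against the corner amounts to testing
    against all of [U]. *)
Lemma corner_semiprime U e :
  is_subalgebra U -> fin_dim U -> semiprime_on U -> U e -> e ** e = e ->
  [/\ is_subalgebra (corner U e), fin_dim (corner U e)
    & semiprime_on (corner U e)].
Proof.
move=> [[U0 [UD UZ]] UM] [s Us] spU Ue ee.
have sC : is_subspace (corner U e).
  split; first by split; rewrite ?numul0l ?numul0r.
  split=> [x y [Ux ex xe] [Uy ey ye]|k x [Ux ex xe]].
    by split; [exact: UD|rewrite nua_mulDr ex ey|rewrite nua_mulDl xe ye].
  by split; [exact: UZ|rewrite nua_mulZr ex|rewrite nua_mulZl xe].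
have Ceue u : U u -> corner U e (e ** u ** e).
  move=> Uu; split; first by apply: (UM) => //; apply: UM.
    by rewrite !nua_mulA ee.
  by rewrite -nua_mulA ee.
split.
- split=> // x y [Ux ex xe] [Uy ey ye].
  by split; [exact: UM|rewrite nua_mulA ex|rewrite -nua_mulA ye].
- apply: (@fin_dim_lspan _ _ _ (fun i : 'I_(size s) => e ** s`_i ** e)) => x.
  split=> [[/Us[c xE] ex xe]|[c ->]].
    exists c; rewrite -xe -ex xE numul_sumr numul_suml.
    by apply: eq_bigr => i _; rewrite nua_mulZr nua_mulZl.
  apply: subspace_lincomb => // i; apply: Ceue; apply/Us.
  exact: (lspan_gen (fun i : 'I_(size s) => s`_i)).
- move=> x [Ux ex xe] xCx; apply: spU => // u Uu.
  by rewrite -(xCx _ (Ceue u Uu)) !nua_mulA xe -(nua_mulA _ e) ex.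
Qed.

Definition sum_of C V x := exists a b, [/\ C a, V b & x = a + b].

(** Orthogonality makes the product componentwise; testing against y + 0 and 0 + y separates the two
    components. *)
Lemma orthogonal_sum_semiprime C V :
  is_subalgebra C -> fin_dim C -> semiprime_on C ->
  is_subalgebra V -> fin_dim V -> semiprime_on V ->
  (forall a b, C a -> V b -> a ** b = 0 /\ b ** a = 0) ->
  [/\ is_subalgebra (sum_of C V), fin_dim (sum_of C V)
    & semiprime_on (sum_of C V)].
Proof.
move=> [[C0 [CD CZ]] CM] [s Cs] spC [[V0 [VD VZ]] VM] [t Vt] spV orth.
have mulE a b a' b' : C a -> V b -> C a' -> V b' ->
    (a + b) ** (a' + b') = a ** a' + b ** b'.
  move=> Ca Vb Ca' Vb'; rewrite nua_mulDl !nua_mulDr.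
  by rewrite (orth a b' Ca Vb').1 (orth a' b Ca' Vb).2 addr0 add0r.
split.
- split; last first.
    move=> _ _ [a [b [Ca Vb ->]]] [a' [b' [Ca' Vb' ->]]].
    by exists (a ** a'), (b ** b'); rewrite mulE //; split=> //; [apply: CM|apply: VM].
  split; first by exists 0, 0; rewrite addr0.
  split=> [_ _ [a [b [Ca Vb ->]]] [a' [b' [Ca' Vb' ->]]]|k _ [a [b [Ca Vb ->]]]].
    by exists (a + a'), (b + b'); rewrite addrACA; split=> //; [apply: CD|apply: VD].
  by exists (k *: a), (k *: b); rewrite scalerDr; split=> //; [apply: CZ|apply: VZ].
- apply: (@fin_dim_lspan _ _ _ (fun i : 'I_(size s) + 'I_(size t) =>
    match i with inl i => s`_i | inr j => t`_j end)) => x; split.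
    case=> a [b [/Cs[c ->] /Vt[d ->] ->]].
    exists (fun i => match i with inl i => c i | inr j => d j end).
    by rewrite big_sumType.
  case=> c ->; rewrite big_sumType /=; do 2!eexists; split=> //.
    by apply/Cs; exists (fun i => c (inl i)).
  by apply/Vt; exists (fun i => c (inr i)).
- move=> _ [a [b [Ca Vb ->]]] W0.
  have a0 : a = 0.
    apply: spC => // y Cy.
    have := W0 (y + 0) (ex_intro _ y (ex_intro _ 0 (And3 Cy V0 erefl))).
    rewrite mulE // mulE ?numul0r ?numul0l ?addr0 //; exact: CM.
  rewrite a0 add0r in W0 *; apply: spV => // y Vy.
  by apply: W0; exists 0, y; rewrite add0r.
Qed.

Lemma npow_add x m n : npow x (m + n).+1 = npow x m ** npow x n.
Proof. by elim: m => // m IH; rewrite /= -nua_mulA -IH. Qed.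

Lemma npow_npow x m k : npow (npow x m) k = npow x (m.+1 * k.+1).-1.
Proof.
elim: k => [|k IH]; first by rewrite muln1.
have -> : (m.+1 * k.+2).-1 = (m + (m.+1 * k.+1).-1).+1 by lia.
by rewrite npow_add -IH.
Qed.

Lemma npow_eq0_le x m n : (m <= n)%N -> npow x m = 0 -> npow x n = 0.
Proof.
rewrite leq_eqVlt => /orP[/eqP <- //|lt_mn] xm.
have -> : n = (m + (n - m.+1)).+1 by lia.
by rewrite npow_add xm numul0l.
Qed.

End Assembly.

(** * Lifting from the quotient to the extension *)

Section Extension.
Variables (K : fieldType) (R Q : nualg K) (J : R -> Prop) (pi : R -> Q).
Hypotheses (idJ : is_ideal J) (hom_pi : is_alg_hom pi).
Hypotheses (surj_pi : forall q, exists r, pi r = q).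
Hypothesis (ker_pi : forall r, J r <-> pi r = 0).

Lemma hom_lincomb (I : finType) (c : I -> K) (v : I -> R) :
  pi (\sum_i c i *: v i) = \sum_i c i *: pi (v i).
Proof.
have [piD [piZ piM]] := hom_pi.
rewrite (big_morph pi piD (id1 := 0)); first exact: eq_bigr.
by rewrite -(scale0r 0) piZ scale0r.
Qed.

Lemma hom_npow x n : pi (npow x n) = npow (pi x) n.
Proof. by elim: n => //= n <-; case: hom_pi => _ [_ ->]. Qed.

(** For nilpotent x, the power n+1 dies in [Q], so it is a nilpotent element of [J], and its power
    m+1 is zero. The predecessor in the witness is due to the shift in [npow]. *)
Lemma bounded_index_extension :
  bounded_index_on J -> bounded_index Q -> bounded_index R.
Proof.
move=> [m Jm] [n Qn]; exists (n.+1 * m.+1).-1 => x _ [k xk].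
rewrite -npow_npow; apply: Jm.
  apply/ker_pi; rewrite hom_npow; apply: Qn => //.
  by exists k; rewrite -hom_npow xk; apply/ker_pi; case: idJ => [[]].
by exists k; rewrite npow_npow; apply: npow_eq0_le xk; lia.
Qed.

Lemma locally_fdss_extension : locally_fdss_on J -> bounded_index_on J ->
  locally_fdss Q -> locally_fdss R.
Proof.
move=> /locally_fdss_semiprime lsJ bdJ lQ s _.
have [piD [piZ piM]] := hom_pi; have [sJ [Jl Jr]] := idJ.
have piB x y : pi (x - y) = pi x - pi y by rewrite -scaleN1r piD piZ scaleN1r.
have [//|S [[sS [[t St] ssS]] [_ piS]]] := lQ (map pi s).
pose q (i : 'I_(size t)) := t`_i.
have Sq i : S (q i) by apply/St; exact: (lspan_gen q).
have [r pir] := choice (fun i => surj_pi (q i)).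
have lift x : S (pi x) -> exists y, J y /\ exists c, x = \sum_i c i *: r i + y.
  case/St => c pix; exists (x - \sum_i c i *: r i); split; last first.
    by exists c; rewrite addrC subrK.
  apply/ker_pi; rewrite piB hom_lincomb pix; apply/eqP; rewrite subr_eq0.
  by apply/eqP; apply: eq_bigr => i _; rewrite pir.
have /choice[yr yrP] (p : 'I_(size t) * 'I_(size t)) :
    exists y, J y /\ exists c, r p.1 ** r p.2 = \sum_i c i *: r i + y.
  by apply: lift; rewrite piM !pir; apply: sS.2.
have /choice[ys ysP] (x : R) : exists y, x \in s -> J y /\
    exists c, x = \sum_i c i *: r i + y.
  have [xs|nxs] := boolP (x \in s); last by exists 0.
  by have [y yP] := lift x (piS _ (map_f pi xs)); exists y.
(* The family [q] need not be a basis: the rows of [B] generate its linear relations. Lifted to [R]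
   through [r], they give the errors [yB]. *)
have [B BP] : exists B : 'M[K]_(size t), forall c : 'rV_(size t),
    \sum_i c 0 i *: q i = 0 <-> (c <= B)%MS.
  apply: (@subspace_rowspace _ _ (fun c => \sum_i c 0 i *: q i = 0)).
  - by rewrite big1 // => i _; rewrite mxE scale0r.
  - move=> u v u0 v0; under eq_bigr => i _ do rewrite mxE scalerDl.
    by rewrite big_split /= u0 v0 addr0.
  - move=> k u u0; under eq_bigr => i _ do rewrite mxE -scalerA.
    by rewrite -scaler_sumr u0 scaler0.
pose yB k := \sum_i B k i *: r i.
have JyB k : J (yB k).
  apply/ker_pi; rewrite hom_lincomb.
  have /BP {2}<- := row_sub k B.
  by apply: eq_bigr => i _; rewrite pir mxE.
(* The errors are of three kinds: from products of the [r i], from the elements of [s], and from the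
   relations among the [q i]. *)
pose Y := map yr (enum {: 'I_(size t) * 'I_(size t)}) ++ map ys s ++
  map yB (enum 'I_(size t)).
have Yr p : yr p \in Y by rewrite mem_cat map_f ?mem_enum.
have Ys x : x \in s -> ys x \in Y by move=> xs; rewrite !mem_cat (map_f ys) ?orbT.
have YB k : yB k \in Y by rewrite !mem_cat (map_f yB) ?mem_enum ?orbT.
have JY y : y \in Y -> J y.
  rewrite !mem_cat => /or3P[] /mapP[z zP ->] //; first exact: (yrP z).1.
  exact: (ysP z zP).1.
have [f0 [Jf0 f0f0 f0Y]] : exists f0, [/\ J f0, f0 ** f0 = f0
    & forall y, y \in Y -> f0 ** y = y /\ y ** f0 = y].
  have [U [sU fdU spU UJ YU]] := lsJ Y JY.
  have [f0 [Uf0 f0U]] := semiprime_unit sU fdU spU.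
  exists f0; split; [exact: UJ|exact: (f0U f0 Uf0).1|].
  by move=> y /YU /f0U.
have cl0 : closed_mod r f0.
  move=> i j; have [_ [c cE]] := yrP (i, j); exists c, (yr (i, j)).
  by split=> //; [exact: (f0Y _ (Yr _)).1|exact: (f0Y _ (Yr _)).2].
have [e [Je [_ ee f0e ef0] re]] := central_idempotent idJ lsJ bdJ Jf0 f0f0 cl0.
have eY y : y \in Y -> e ** y = y.
  by move=> /f0Y[f0y _]; rewrite -f0y nua_mulA ef0.
have Ye y : y \in Y -> y ** e = y.
  by move=> /f0Y[_ yf0]; rewrite -yf0 -nua_mulA f0e.
have [U [sU fdU spU UJ inU]] : exists U, [/\ is_subalgebra U, fin_dim U,
    semiprime_on U, forall x, U x -> J x & forall x,
      x \in e :: Y ++ map (fun i => e ** r i) (enum 'I_(size t)) -> U x].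
  apply: lsJ => x; rewrite in_cons mem_cat => /or3P[/eqP -> //|/JY //|].
  by case/mapP => i _ ->; apply: Jr.
have Ue : U e by apply: inU; rewrite mem_head.
have [sC fdC spC] := corner_semiprime sU fdU spU Ue ee.
have CY y : y \in Y -> corner U e y.
  move=> yY; split; [|exact: eY|exact: Ye].
  by apply: inU; rewrite in_cons mem_cat yY orbT.
have Cer i : corner U e (e ** r i).
  split; last by rewrite -nua_mulA re nua_mulA ee.
    apply: inU; rewrite in_cons mem_cat.
    by rewrite (map_f (fun i => e ** r i)) ?mem_enum ?orbT.
  by rewrite nua_mulA ee.
pose v i := r i - e ** r i.
have lcE c : \sum_i c i *: v i = \sum_i c i *: r i - e ** \sum_i c i *: r i.
  rewrite numul_sumr -sumrB; apply: eq_bigr => i _.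
  by rewrite scalerBr nua_mulZr.
have ev i : e ** v i = 0 by rewrite numulBr nua_mulA ee subrr.
have ve i : v i ** e = 0 by rewrite numulBl re -nua_mulA re nua_mulA ee subrr.
have sV : is_subspace (lspan v) := lspan_subspace v.
have orth a b : corner U e a -> lspan v b -> a ** b = 0 /\ b ** a = 0.
  move=> [_ ea ae] [c ->]; split.
    rewrite -ae -nua_mulA numul_sumr big1 ?numul0r // => i _.
    by rewrite nua_mulZr ev scaler0.
  rewrite -ea nua_mulA numul_suml big1 ?numul0l // => i _.
  by rewrite nua_mulZl ve scaler0.
have aV : is_subalgebra (lspan v).
  split=> // _ _ [c ->] [d ->].
  have -> : (\sum_i c i *: v i) ** (\sum_j d j *: v j) =
      \sum_i c i *: \sum_j d j *: (v i ** v j).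
    rewrite numul_suml; apply: eq_bigr => i _.
    rewrite nua_mulZl numul_sumr; congr (_ *: _).
    by apply: eq_bigr => j _; rewrite nua_mulZr.
  apply: subspace_lincomb => // i; apply: subspace_lincomb => // j.
  (* As e commutes with the [r i], v i v j = r i r j - e r i r j, and the error [yr (i, j)] cancels
     because e fixes it. *)
  have [_ [c' /= rr]] := yrP (i, j); exists c'; rewrite lcE.
  have -> : v i ** v j = r i ** r j - e ** (r i ** r j).
    rewrite {1}/v numulBl -re -(nua_mulA (r i)) ev numul0r subr0.
    by rewrite /v numulBr !nua_mulA re.
  by rewrite rr nua_mulDr (eY _ (Yr _)) opprD addrACA subrr addr0.
have pie : pi e = 0 by apply/ker_pi.
have piv i : pi (v i) = q i.
  by rewrite piB piM pie numul0l subr0 pir.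
(* A relation among the [q i] is a combination of the rows of [B], so b has the form y - e y with y
   a combination of the [yB k], all fixed by e. *)
have piV b : lspan v b -> pi b = 0 -> b = 0.
  move=> [c ->]; rewrite hom_lincomb => c0.
  have /BP/submxP[D DE] : \sum_i (\row_i c i) 0 i *: q i = 0.
    by rewrite -[RHS]c0; apply: eq_bigr => i _; rewrite mxE piv.
  have cE i : c i = \sum_k D 0 k * B k i.
    by have := congr1 (fun u : 'rV_(size t) => u 0 i) DE; rewrite !mxE.
  rewrite lcE.
  have -> : \sum_i c i *: r i = \sum_k D 0 k *: yB k.
    rewrite (eq_bigr (fun i => \sum_k (D 0 k * B k i) *: r i)); last first.
      by move=> i _; rewrite cE scaler_suml.
    rewrite exchange_big; apply: eq_bigr => k _; rewrite scaler_sumr.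
    by apply: eq_bigr => i _; rewrite scalerA.
  rewrite numul_sumr -sumrB big1 // => k _.
  by rewrite nua_mulZr eY // subrr.
(* [pi] maps the span of [v] bijectively onto [S], so semiprimeness is pulled back from [S]. *)
have spV : semiprime_on (lspan v).
  move=> b Vb b0; apply: piV => //; have spS := semisimple_semiprime sS ssS.
  apply: spS => [|_ /St[c ->]].
    by case: Vb => c ->; rewrite hom_lincomb; apply/St; exists c;
      apply: eq_bigr => i _; rewrite piv.
  have -> : \sum_i c i *: t`_i = pi (\sum_i c i *: v i).
    by rewrite hom_lincomb; apply: eq_bigr => i _; rewrite piv.
  rewrite -!piM b0; last by exists c.
  by apply/ker_pi; case: sJ.
have fdV : fin_dim (lspan v) by apply: (@fin_dim_lspan _ _ _ v).
have [aW fdW spW] := orthogonal_sum_semiprime sC fdC spC aV fdV spV orth.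
exists (sum_of (corner U e) (lspan v)); split; last split=> // x xs.
  by split=> //; split=> //; apply: semiprime_semisimple.
have [_ [c xE]] := ysP x xs.
(* Each [r i] splits as e r i, in the corner, plus [v i]; the error [ys x] goes to the corner. *)
exists (\sum_i c i *: (e ** r i) + ys x), (\sum_i c i *: v i); split.
- apply: sC.1.2.1; last exact/CY/Ys.
  by apply: subspace_lincomb => //; case: sC.
- by exists c.
- rewrite {1}xE lcE numul_sumr addrAC; congr (_ + _); rewrite addrC.
  rewrite -[LHS](subrK (\sum_i e ** (c i *: r i))); congr (_ + _).
  by apply: eq_bigr => i _; rewrite nua_mulZr.
Qed.

End Extension.

(* The quotient R/J is represented by any algebra Q together with a
   surjective algebra homomorphism pi : R -> Q whose kernel is exactly J. *)
Theorem theorem4p9 (K : fieldType) (R : nualg K) (J : R -> Prop)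
  (Q : nualg K) (pi : R -> Q) :
  is_ideal J ->
  is_alg_hom pi -> (forall q : Q, exists r : R, pi r = q) ->
  (forall r : R, J r <-> pi r = 0%R) ->
  locally_fdss_on J -> bounded_index_on J ->
  locally_fdss Q -> bounded_index Q ->
  locally_fdss R /\ bounded_index R.
Proof.
move=> idJ hom_pi surj_pi ker_pi lJ bJ lQ bQ; split.
  exact: (locally_fdss_extension idJ hom_pi surj_pi ker_pi).
exact: (bounded_index_extension idJ hom_pi ker_pi).
Qed.
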